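(* The proportional schemes are the only reward sharing schemes satisfying round based rewards, budget limit, fixed total reward, ordinality, absolute redistribution, relative redistribution and strict positivity. That is, a reward sharing scheme $\alpha$ satisfies these seven axioms if and only if there is a constant $R\in(0,B]$ such that $\alpha(s,H)=\frac{R}{|P(s)|}$ for every history $H=(S,\mathcal{P}(S))$ and every share $s\in S$.
   Context: $B>0$ is a fixed constant (the block reward). Shares and histories. Let $\mathcal{S}$ be a nonempty set (of admissible hashes) and $T=\mathbb{R}$ the set of time signatures. A share is a pair $s=(h,t)\in\mathcal{S}\times T$; its time signature is $\tau(s)=t$. A history is a pair $H=(S,\mathcal{P}(S))$ where $S=\{s_1,\dots,s_m\}$ is a nonempty finite set of shares with pairwise distinct time signatures, listed in increasing order of time signature, and $\mathcal{P}(S)=\{P_1,\dots,P_l\}$ is a partition of $S$ into nonempty sets of consecutive shares, called rounds, numbered in chronological order (the last share of each round is the ''full solution'' ending that round; this information is carried only by the partition). For $s\in S$, $P(s)$ is the round containing $s$. A reward sharing scheme $\alpha$ assigns to every history $H=(S,\mathcal{P}(S))$ and every $s\in S$ an award $\alpha(s,H)\in\mathbb{R}_+=[0,\infty)$. Restriction: for a history $H$ and a round $P_r$ of it, $H|_r=(P_r,\{P_r\})$. Extension: $H'=(S',\mathcal{P}'(S'))$ is an extension of $H$ at the $r$-th round if $S'=S\cup\{s^*\}$ for a share $s^*\notin S$ with $\tau(\underline{s})<\tau(s^* )<\tau(\overline{s})$ for all $\underline{s}\in P_r$ and all $\overline{s}\in P_{r+1}$ (the latter inequality only if round $r+1$ exists),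 $P'_k=P_k$ for all $k\ne r$, and $P'_r=P_r\cup\{s^*\}$. Time-shift: for $s_i\in P_r$, $H'=(S',\mathcal{P}'(S'))$ is a time-shift of $H$ at $s_i$ if $S'=(S\setminus\{s_i\})\cup\{s_i'\}$ for some share $s_i'\in(\mathcal{S}\times T)\setminus S$ with $\tau(s_{i-1})<\tau(s_i')<\tau(s_{i+1})$ (an inequality being dropped if the corresponding neighbouring share does not exist), $P'_j=P_j$ for all $j\neq r$, and hence $P'_r=(P_r\setminus\{s_i\})\cup\{s_i'\}$. Axioms for a scheme $\alpha$: - Fixed total reward: for every history $H=(S,\mathcal{P}(S))$ and all rounds $P,P'\in\mathcal{P}(S)$, $\sum_{s\in P}\alpha(s,H)=\sum_{s\in P'}\alpha(s,H)$. - Ordinality: for every $H=(S,\mathcal{P}(S))$ and every time-shift $H'$ of $H$ at any $s_i\in S$, $\alpha(s,H)=\alpha(s,H')$ for all $s\in S\setminus\{s_i\}$. - Budget limit: for every history $H$ and every round $P$ of $H$, $\sum_{s\in P}\alpha(s,H)\le B$. - Round based rewards: for every history $H$, every round $P_r$ of $H$ and every $s\in P_r$, $\alpha(s,H)=\alpha(s,H|_r)$. - Absolute redistribution: for every history $H$, every round $P_r$ with $|P_r|>1$, every extension $H'$ of $H$ at the $r$-th round, and all $s_i,s_j\in P_r$, $\alpha(s_i,H)-\alpha(s_i,H')=\alpha(s_j,H)-\alpha(s_j,H')$. - Relative redistribution: for every history $H$, every round $P_r$ with $|P_r|>1$, every extension $H'$ of $H$ at the $r$-th round, and all $s_i,s_j\in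 P_r$ with $\alpha(s_i,H)\neq0$ and $\alpha(s_j,H)\ne0$, $\frac{\alpha(s_i,H')}{\alpha(s_i,H)}=\frac{\alpha(s_j,H')}{\alpha(s_j,H)}$. - Strict positivity: for every history $H=(S,\mathcal{P}(S))$ and every $s\in S$, $\alpha(s,H)>0$. *)

(* Defs.v *)
From mathcomp Require Export all_boot all_order all_algebra finmap reals.

Set Implicit Arguments.
Unset Strict Implicit.
Unset Printing Implicit Defensive.

Import Order.TTheory GRing.Theory Num.Theory.
Local Open Scope fset_scope.
Local Open Scope ring_scope.

Section Histories.
Variables (R : realType) (Hash : choiceType).

Definition share : Type := (Hash * R)%type.

Definition tau (s : share) : R := s.2.

(* The partition is stored as the chronological list P_1, ..., P_l of its
   blocks.  The last condition says that every share of an earlier block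
   precedes every share of a later one; as the blocks cover S, it makes them
   pairwise disjoint, consecutive and chronologically numbered. *)
Definition is_history (S : {fset share}) (Ps : seq {fset share}) : bool :=
  [&& S != fset0,
      uniq [seq tau s | s <- S],
      S == (\bigcup_(P <- Ps) P)%fset,
      all (fun P => P != fset0) Ps &
      pairwise (fun P Q : {fset share} =>
                  allrel (fun s s' => tau s < tau s') P Q) Ps].

Record history : Type := History {
  shares : {fset share};
  rounds : seq {fset share};
  historyP : is_history shares rounds
}.

(* Rounds are numbered from 0; indices out of range give the empty set. *)
Definition round (H : history) (r : nat) : {fset share} :=
  nth fset0 (rounds H) r.

Definition round_index (H : history) (s : share) : nat :=
  find (fun P : {fset share} => s \in P) (rounds H).

Definition round_of (H : history) (s : share) : {fset share} :=
  round H (round_index H s).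

(* s_1, ..., s_m, in increasing order of time signature *)
Definition listing (H : history) : seq share :=
  sort (fun s s' => tau s <= tau s') (shares H).

Lemma restriction_subproof (H : history) (r : 'I_(size (rounds H))) :
  is_history (round H r) [:: round H r].
Proof.
have Pr : round H r \in rounds H by apply: mem_nth.
case/and5P: (historyP H) => _ utau /eqP defS /allP ne _.
apply/and5P; split; rewrite ?big_seq1 ?eqxx //= ?andbT; try exact: ne.
have sub : {subset round H r <= shares H}.
  by move=> s sP; rewrite defS; apply/bigfcupP; exists (round H r); rewrite ?Pr.
have perm : perm_eq (round H r) [seq s <- shares H | s \in round H r].
  apply: uniq_perm; rewrite ?filter_uniq ?fset_uniq // => s.
  by rewrite mem_filter andb_idr //; apply: sub.
rewrite (perm_uniq (perm_map tau perm)).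
by apply: subseq_uniq utau; apply/map_subseq/filter_subseq.
Qed.

Definition restriction (H : history) (r : 'I_(size (rounds H))) : history :=
  History (restriction_subproof r).

(* When r is the last round, [round H r.+1] is empty, so that the upper bound
   on the time signature of the new share is vacuous. *)
Definition is_extension (H : history) (r : 'I_(size (rounds H)))
    (H' : history) : Prop :=
  exists s' : share,
    [/\ s' \notin shares H,
        forall s, s \in round H r -> tau s < tau s',
        forall s, s \in round H r.+1 -> tau s' < tau s,
        shares H' = s' |` shares H &
        rounds H' = set_nth fset0 (rounds H) r (s' |` round H r)].

Definition is_time_shift (H : history) (s : share) (H' : history) : Prop :=
  let L := listing H in
  let i := index s L in
  let r := round_index H s in
  exists s' : share,
    [/\ s' \notin shares H,
        (0 < i)%N -> tau (nth s L i.-1) < tau s',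
        (i.+1 < size L)%N -> tau s' < tau (nth s L i.+1),
        shares H' = s' |` (shares H `\ s) &
        rounds H' = set_nth fset0 (rounds H) r (s' |` (round H r `\ s))].

(* The values [award s H] with [s \notin shares H] are meaningless, and are
   left unconstrained everywhere. *)
Record scheme : Type := Scheme {
  award :> share -> history -> R;
  award_ge0 : forall s H, s \in shares H -> 0 <= award s H
}.

Implicit Type alpha : scheme.

Definition fixed_total_reward alpha : Prop :=
  forall (H : history) (P P' : {fset share}),
    P \in rounds H -> P' \in rounds H ->
    \sum_(s <- P) alpha s H = \sum_(s <- P') alpha s H.

Definition ordinality alpha : Prop :=
  forall (H : history) (si : share) (H' : history),
    si \in shares H -> is_time_shift H si H' ->
    forall s, s \in shares H `\ si -> alpha s H = alpha s H'.

Definition budget_limit (B : R) alpha : Prop :=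
  forall (H : history) (P : {fset share}),
    P \in rounds H -> \sum_(s <- P) alpha s H <= B.

Definition round_based_rewards alpha : Prop :=
  forall (H : history) (r : 'I_(size (rounds H))) (s : share),
    s \in round H r -> alpha s H = alpha s (restriction r).

Definition absolute_redistribution alpha : Prop :=
  forall (H : history) (r : 'I_(size (rounds H))) (H' : history),
    (1 < #|` round H r|)%N -> is_extension r H' ->
    forall si sj, si \in round H r -> sj \in round H r ->
    alpha si H - alpha si H' = alpha sj H - alpha sj H'.

Definition relative_redistribution alpha : Prop :=
  forall (H : history) (r : 'I_(size (rounds H))) (H' : history),
    (1 < #|` round H r|)%N -> is_extension r H' ->
    forall si sj, si \in round H r -> sj \in round H r ->
    alpha si H != 0 -> alpha sj H != 0 ->
    alpha si H' / alpha si H = alpha sj H' / alpha sj H.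

Definition strict_positivity alpha : Prop :=
  forall (H : history) (s : share), s \in shares H -> 0 < alpha s H.

Definition proportional (rho : R) alpha : Prop :=
  forall (H : history) (s : share),
    s \in shares H -> alpha s H = rho / (#|` round_of H s|)%:R.

End Histories.

(* Main.v *)
Require Import Defs.

Set Implicit Arguments.
Unset Strict Implicit.
Unset Printing Implicit Defensive.

Import Order.TTheory GRing.Theory Num.Theory.
Local Open Scope fset_scope.

Local Open Scope ring_scope.

(** By fixed total reward, two rounds that can coexist in a history have the
    same total reward; any two rounds can be compared with a common later
    round, so this total is a constant [rho].  Appending a share to a round with
    at least two shares multiplies all old awards by one factor [c] and lowers
    all of them by one amount [d], so that [(1 - c) a = d] for each old award
    [a].  The new share has a positive award while the total is unchanged, hence
    [d != 0], and the old awards are equal. *)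

(** * Rounds of a history, and histories built from given sets of shares *)

Section HistoryFacts.
Variables (R : realType) (Hash : choiceType).
Implicit Types (H : history R Hash) (P : {fset share R Hash}).
Implicit Types (s : share R Hash).

(** The validity proof is an equality of booleans, hence unique. *)
Lemma history_eq H H' : shares H = shares H' -> rounds H = rounds H' -> H = H'.
Proof.
case: H H' => [S Ps p] [S' Ps' p'] /= eqS eqPs; subst S' Ps'.
by rewrite (bool_irrelevance p p').
Qed.

Lemma mem_round_lt H r s : s \in round H r -> (r < size (rounds H))%N.
Proof. by case: ltnP => // le; rewrite /round nth_default. Qed.

Lemma mem_sharesP H s :
  reflect (exists r, s \in round H r) (s \in shares H).
Proof.
case/and5P: (historyP H) => _ _ /eqP -> _ _.
apply: (iffP (bigfcupP _ _ _ _)) => [[P /andP[PH _] sP]|[r sr]].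
  by exists (index P (rounds H)); rewrite /round nth_index.
by exists (round H r); rewrite // mem_nth // (mem_round_lt sr).
Qed.

Lemma round_neq0 H P : P \in rounds H -> P != fset0.
Proof. by case/and5P: (historyP H) => _ _ _ /allP ne _; apply: ne. Qed.

(** A share lying in two distinct rounds would be strictly earlier than itself. *)
Lemma mem_round_inj H r r' s : s \in round H r -> s \in round H r' -> r = r'.
Proof.
wlog lt_rr' : r r' / (r < r')%N => [W sr sr'|sr sr'].
  by case: (ltngtP r r') => // lt; [apply: W | apply/esym/W].
case/and5P: (historyP H) => _ _ _ _ /(pairwiseP fset0) ord.
have := ord r r' (mem_round_lt sr) (mem_round_lt sr') lt_rr'.
by move/allrelP/(_ s s sr sr'); rewrite ltxx.
Qed.

Lemma round_of_mem H r s : s \in round H r -> round_of H s = round H r.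
Proof.
move=> sr; rewrite /round_of; congr round.
apply: (@mem_round_inj H _ _ s) => //.
apply: (nth_find fset0 (a := fun P : {fset share R Hash} => s \in P)).
by apply/hasP; exists (round H r); rewrite // mem_nth // (mem_round_lt sr).
Qed.

Lemma mem_round_of H s : s \in shares H -> s \in round_of H s.
Proof. by case/mem_sharesP => r sr; rewrite (round_of_mem sr). Qed.

Lemma mem_round_shares H P s : P \in rounds H -> s \in P -> s \in shares H.
Proof.
move=> PH sP; apply/mem_sharesP; exists (index P (rounds H)).
by rewrite /round nth_index.
Qed.

Lemma card_round_of_gt0 H s : s \in shares H -> (0 < #|` round_of H s|)%N.
Proof. by move/mem_round_of => sP; rewrite cardfs_gt0; apply/fset0Pn; exists s. Qed.

(** The shifted round loses [si] and gains a share from outside [H], and every other round is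
    untouched. This gives ordinality of proportional schemes. *)
Lemma card_round_of_time_shift H si H' s :
  si \in shares H -> is_time_shift H si H' -> s \in shares H `\ si ->
  #|` round_of H' s| = #|` round_of H s|.
Proof.
move=> siH [s' [s'H _ _ _ eqPs]]; rewrite in_fsetD1 => /andP[s_si sH].
have sir := mem_round_of siH; have [k sk] := mem_sharesP _ _ sH.
have roundH' j : round H' j = if j == round_index H si
    then s' |` (round_of H si `\ si) else round H j.
  by rewrite /round eqPs nth_set_nth /=.
rewrite (round_of_mem sk); have := roundH' k; case: eqP => [ek|_] eqk; last first.
  by rewrite (@round_of_mem H' k) eqk.
have eqr : round H k = round_of H si by rewrite ek.
rewrite (@round_of_mem H' k); last first.
  by rewrite eqk !inE s_si -eqr sk orbT.
rewrite eqk eqr cardfsU1 [in RHS](cardfsD1 si) sir; congr addn.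
rewrite in_fsetD1 negb_and; suff -> : s' \notin round_of H si by rewrite orbT.
apply: contra s'H => s'r; apply/mem_sharesP; exists (round_index H si).
exact: s'r.
Qed.

(** These are exactly the sets that occur as a round of some history: [round_like_round] gives one
    direction and [single] the other. *)
Definition round_like P : bool := (P != fset0) && uniq [seq tau s | s <- P].

Lemma single_subproof P : round_like P -> is_history P [:: P].
Proof. by case/andP=> P0 uP; apply/and5P; split; rewrite ?big_seq1 //= ?andbT. Qed.

Definition single P (rP : round_like P) : history R Hash :=
  History (single_subproof rP).

Lemma round_like_round H r : (r < size (rounds H))%N -> round_like (round H r).
Proof.
move=> lt_r; have /and5P[P0 uP _ _ _] := historyP (restriction (Ordinal lt_r)).
exact/andP.
Qed.

Lemma restriction_single H (r : 'I_(size (rounds H))) (rP : round_like (round H r)) :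
  restriction r = single rP.
Proof. exact: history_eq. Qed.

Lemma round_like1 s : round_like [fset s].
Proof.
rewrite /round_like; apply/andP; split; last by rewrite enum_fsetE enum_fset1.
by apply/fset0Pn; exists s; rewrite inE.
Qed.

Lemma uniq_tau_fsetU1 P s : uniq [seq tau s | s <- P] ->
  (forall u, u \in P -> tau u < tau s) -> uniq [seq tau s | s <- s |` P].
Proof.
move=> uP ltP; have sP : s \notin P by apply/negP => /ltP; rewrite ltxx.
have perm : perm_eq (s |` P) (s :: P).
  by apply: uniq_perm; rewrite ?fset_uniq //= ?sP ?fset_uniq // => u; rewrite !inE.
rewrite (perm_uniq (perm_map _ perm)) /= uP andbT.
by apply/mapP => -[u /ltP lt_us eq_us]; rewrite eq_us ltxx in lt_us.
Qed.

Lemma round_likeU1 P s : round_like P ->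
  (forall u, u \in P -> tau u < tau s) -> round_like (s |` P).
Proof.
move=> /andP[_ uP] ltP; rewrite /round_like uniq_tau_fsetU1 // andbT.
by apply/fset0Pn; exists s; rewrite fset1U1.
Qed.

(** The share [s] forms a second round by itself, so that fixed total reward can compare its award
    with the total of [P]. *)
Lemma append_round_subproof P s : round_like P ->
  (forall u, u \in P -> tau u < tau s) -> is_history (s |` P) [:: P; [fset s]].
Proof.
move=> rP ltP; have /andP[sP0 usP] := round_likeU1 rP ltP.
have /andP[s0 _] := round_like1 s; have /andP[P0 _] := rP.
apply/and5P; split=> //=; rewrite ?P0 ?s0 //; last first.
  by rewrite !andbT; apply/allrelP => u v /ltP lt_us /fset1P ->.
by rewrite big_cons big_seq1 fsetUC.
Qed.

Lemma exists_tau_bound P : exists M, forall s, s \in P -> tau s < M.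
Proof.
(* The sum dominates the absolute value of each [tau s], and the added 1 makes the bound strict. *)
exists (1 + \sum_(s <- P) `|tau s|) => s sP.
rewrite (big_fsetD1 s) //= addrCA; apply: le_lt_trans (ler_norm _) _.
by rewrite ltrDl ltr_wpDr // sumr_ge0.
Qed.

End HistoryFacts.

(** * Proportional schemes satisfy the axioms *)

Section ProportionalSchemes.
Variables (R : realType) (Hash : choiceType) (alpha : scheme R Hash).
Variables (rho : R).
Hypothesis prop_alpha : proportional rho alpha.

Lemma proportional_round H r s :
  s \in round H r -> alpha s H = rho / #|` round H r|%:R.
Proof.
move=> sr; rewrite prop_alpha ?(round_of_mem sr) //.
by apply/mem_sharesP; exists r.
Qed.

Lemma proportional_total H P : P \in rounds H -> \sum_(s <- P) alpha s H = rho.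
Proof.
move=> PH; have eqP : round H (index P (rounds H)) = P by rewrite /round nth_index.
rewrite (eq_big_seq (fun=> rho / #|` P|%:R)) => [|s sP]; last first.
  by rewrite -[in RHS]eqP; apply: proportional_round; rewrite eqP.
rewrite big_const_seq count_predT iter_addr_0 -[_ *+ _]mulr_natr divfK //.
by rewrite pnatr_eq0 cardfs_eq0 (round_neq0 PH).
Qed.

Lemma proportional_round_based : round_based_rewards alpha.
Proof.
move=> H r s sr; rewrite (proportional_round sr).
(* Round 0 of the restriction is round [r] of [H]. *)
by rewrite (@proportional_round (restriction r) 0).
Qed.

Lemma proportional_ordinality : ordinality alpha.
Proof.
move=> H si H' siH tsh s ssi; have := ssi; rewrite in_fsetD1 => /andP[_ sH].
rewrite !prop_alpha ?(card_round_of_time_shift siH tsh ssi) //.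
by have [s' [_ _ _ -> _]] := tsh; rewrite in_fsetU ssi orbT.
Qed.

(** The round gains exactly one share. The value does not depend on [s], which yields both
    redistribution axioms. *)
Lemma proportional_extension H (r : 'I_(size (rounds H))) H' s :
  is_extension r H' -> s \in round H r ->
  alpha s H' = rho / #|` round H r|.+1%:R.
Proof.
move=> [s' [s'H _ _ _ eqPs]] sr.
have eqr : round H' r = s' |` round H r by rewrite /round eqPs nth_set_nth /= eqxx.
rewrite (@proportional_round H' r) eqr; last by rewrite in_fsetU sr orbT.
rewrite cardfsU1; suff -> : s' \notin round H r by [].
by apply: contra s'H => s'r; apply/mem_sharesP; exists r.
Qed.

Lemma proportional_absolute : absolute_redistribution alpha.
Proof.
move=> H r H' _ ext si sj sir sjr.
by rewrite !(proportional_extension ext) // !(@proportional_round H r).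
Qed.

Lemma proportional_relative : relative_redistribution alpha.
Proof.
move=> H r H' _ ext si sj sir sjr _ _.
by rewrite !(proportional_extension ext) // !(@proportional_round H r).
Qed.

Lemma proportional_gt0 : 0 < rho -> strict_positivity alpha.
Proof.
move=> rho_gt0 H s sH.
by rewrite prop_alpha // divr_gt0 // ltr0n card_round_of_gt0.
Qed.

End ProportionalSchemes.

(** * The axioms force proportionality *)

Section Characterization.
Variables (R : realType) (Hash : choiceType) (alpha : scheme R Hash).
Hypotheses (rbr : round_based_rewards alpha) (ftr : fixed_total_reward alpha).
Implicit Types (P : {fset share R Hash}) (s : share R Hash) (h : Hash).

Lemma award_single H r (rP : round_like (round H r)) s :
  s \in round H r -> alpha s H = alpha s (single rP).
Proof.
move=> sr; have lt_r := mem_round_lt sr.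
by rewrite (rbr (r := Ordinal lt_r) sr) (restriction_single (r := Ordinal lt_r) rP).
Qed.

(** Both sets are rounds of one two-round history, where their totals agree; round based rewards
    carries this over to the one-round histories. *)
Lemma total_single_before P (rP : round_like P) s :
  (forall u, u \in P -> tau u < tau s) ->
  \sum_(u <- P) alpha u (single rP) = alpha s (single (round_like1 s)).
Proof.
move=> ltP; pose H := History (append_round_subproof rP ltP).
transitivity (\sum_(u <- P) alpha u H).
  by apply: eq_big_seq => u uP; rewrite (@award_single H 0 rP).
rewrite (ftr (H := H) (P' := [fset s])) ?inE ?eqxx ?orbT //.
by rewrite big_seq_fset1 (@award_single H 1 (round_like1 s)) // inE.
Qed.

(** [P] and the reference share at time 0 may overlap in time, so each is compared with one share
    later than both. *)
Lemma total_single h P (rP : round_like P) :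
  \sum_(u <- P) alpha u (single rP) = alpha (h, 0) (single (round_like1 (h, 0))).
Proof.
have [M ltM] := exists_tau_bound ((h, 0) |` P).
rewrite (total_single_before rP (s := (h, M))); last first.
  by move=> u uP; apply: ltM; rewrite in_fsetU uP orbT.
rewrite -(total_single_before (round_like1 (h, 0)) (s := (h, M))) ?big_seq_fset1 //.
by move=> u /fset1P ->; apply: ltM; rewrite fset1U1.
Qed.

Hypotheses (abs_red : absolute_redistribution alpha).
Hypotheses (rel_red : relative_redistribution alpha).
Hypotheses (pos : strict_positivity alpha).

Lemma award_single_eq h P (rP : round_like P) si sj :
  si \in P -> sj \in P -> alpha si (single rP) = alpha sj (single rP).
Proof.
move=> siP sjP; have [<-//|ne_ij] := eqVneq si sj.
have cardP : (1 < #|` P|)%N.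
  rewrite (cardfsD1 si) siP ltnS cardfs_gt0; apply/fset0Pn; exists sj.
  by rewrite !inE eq_sym ne_ij.
have [M ltM] := exists_tau_bound P; pose s' : share R Hash := (h, M).
have s'P : s' \notin P by apply/negP => /ltM; rewrite ltxx.
pose H := single rP; pose H' := single (round_likeU1 (s := s') rP ltM).
(* As [H] has only one round, nothing bounds the time of [s'] from above. *)
have ext : @is_extension _ _ H ord0 H' by exists s'.
have absE u : u \in P -> alpha u H - alpha u H' = alpha si H - alpha si H'.
  by move=> uP; exact: (abs_red (H := H) (r := ord0) cardP ext).
have neq0 u : u \in P -> alpha u H != 0 by move=> uP; rewrite gt_eqF ?pos.
have relE := rel_red (H := H) (r := ord0) cardP ext siP sjP (neq0 _ siP) (neq0 _ sjP).
set c := alpha si H' / alpha si H in relE.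
have si' : alpha si H' = c * alpha si H by rewrite divfK ?neq0.
have sj' : alpha sj H' = c * alpha sj H by rewrite relE divfK ?neq0.
(* If [c] were 1, no old award would change; since the totals of [H] and [H'] agree, the award of
   [s'] would be 0. *)
have c_neq1 : 1 - c != 0.
  apply/eqP => c1; have : \sum_(u <- P) alpha u H = \sum_(u <- s' |` P) alpha u H'.
    by rewrite !(total_single h).
  rewrite big_fsetU1 //= (eq_big_seq (fun u => alpha u H')) => [|u uP]; last first.
    apply/eqP; rewrite -subr_eq0 absE // si' -[X in X - _]mul1r -mulrBl c1 mul0r.
    by rewrite eqxx.
  move/eqP; rewrite -[X in X == _]add0r (inj_eq (addIr _)) lt_eqF // pos //=.
  exact: fset1U1.
(* Multiplied by [1 - c], each of the two awards becomes the common loss. *)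
apply: (mulfI c_neq1); rewrite !mulrBl !mul1r -si' -sj'.
by rewrite [RHS]absE.
Qed.

(** The awards in a round are equal and add up to the reference total, so each is that total divided
    by the size of the round. *)
Lemma award_proportional h :
  proportional (alpha (h, 0) (single (round_like1 (h, 0)))) alpha.
Proof.
move=> H s sH; have sP := mem_round_of sH.
have rP : round_like (round_of H s) by apply: round_like_round (mem_round_lt sP).
rewrite (award_single rP) // -(total_single h rP).
rewrite (eq_big_seq (fun=> alpha s (single rP))); last first.
  by move=> u uP; apply: award_single_eq.
rewrite big_const_seq count_predT iter_addr_0 -[_ *+ _]mulr_natr mulfK //.
by rewrite pnatr_eq0 -lt0n card_round_of_gt0.
Qed.

End Characterization.

Theorem corollary1 (R : realType) (Hash : choiceType) (Hash_ne : inhabited Hash)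
    (B : R) (B_gt0 : 0 < B) (alpha : scheme R Hash) :
  (round_based_rewards alpha /\
   budget_limit B alpha /\
   fixed_total_reward alpha /\
   ordinality alpha /\
   absolute_redistribution alpha /\
   relative_redistribution alpha /\
   strict_positivity alpha)
  <->
  (exists rho : R, 0 < rho <= B /\ proportional rho alpha).
Proof.
split=> [[rbr [bl [ftr [_ [abs_red [rel_red pos]]]]]]|[rho [/andP[rho_gt0 rhoB] prop]]].
  (* The constant is the award of a share that is alone in its history; the hash [h] and the time 0
     are arbitrary choices. *)
  case: Hash_ne => h; exists (alpha (h, 0) (single (round_like1 (h, 0)))).
  split; last exact: award_proportional.
  rewrite pos /=; last by rewrite fset11.
  (* The total of the only round of this history is the constant itself. *)
  have := bl (single (round_like1 (h, 0))) [fset (h, 0)].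
  by rewrite big_seq_fset1 inE eqxx; apply.
split; first exact: proportional_round_based prop.
split; first by move=> H P PH; rewrite (proportional_total prop).
split; first by move=> H P P' PH P'H; rewrite !(proportional_total prop).
split; first exact: proportional_ordinality prop.
split; first exact: proportional_absolute prop.
split; first exact: proportional_relative prop.
exact: proportional_gt0 prop rho_gt0.
Qed.
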